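(* Let $D,\Gamma_1,\Gamma_2,\Gamma_3,V,c_0,c_3$ be as in the context, and assume that the data $\mu,f_0,f_2,g$ satisfy: (1) $\mu\in L^\infty(D)$ and there exists $\mu^*>0$ such that $\mu(x)\ge\mu^*$ for a.e. $x\in D$; (2) $f_0\in L^2(D)$; (3) $f_2\in L^2(\Gamma_2)$; (4) $g$ is an admissible friction bound (as defined in the context) with Lipschitz constant $L_g>0$; (5) $L_g\,c_0^2\,c_3^2<\mu^*$. For each $n\in\mathbb N$ let $\mu_n\in L^\infty(D)$ be such that there exists $\mu_n^*>0$ with $\mu_n(x)\ge\mu_n^*$ for a.e. $x\in D$, and assume that $\mu_n\to\mu$ in $L^\infty(D)$ as $n\to\infty$. Let $u\in V$ be the solution of Problem $\mathcal P$ with data $\mu,f_0,f_2,g$ and, for each $n$, let $u_n\in V$ be the solution of Problem $\mathcal P$ with data $\mu_n,f_0,f_2,g$ (that is, an element of $V$ satisfying the corresponding quasivariational inequality). Then $u_n\to u$ strongly in $V$ as $n\to\infty$.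
   Context: Setting. $D\subset\mathbb R^2$ is a regular bounded domain with smooth boundary $\Gamma=\partial D$, composed of three measurable sets $\overline\Gamma_1,\overline\Gamma_2,\overline\Gamma_3$, where $\Gamma_1,\Gamma_2,\Gamma_3$ are mutually disjoint and relatively open in $\Gamma$, and the one-dimensional measure of $\Gamma_1$ is strictly positive. $V=\{v\in H^1(D): v=0\text{ on }\Gamma_1\}$ (in the sense of traces), with the inner product $(\cdot,\cdot)_V$ induced by $H^1(D)$ and associated norm $\|\cdot\|_V$; it is a real Hilbert space. Functions of $V$ are identified with their traces on the boundary where needed. $c_0,c_3>0$ are constants such that $\|v\|_V\le c_0\|\nabla v\|_{L^2(D)^2}$ and $\|v\|_{L^2(\Gamma_3)}\le c_3\|v\|_V$ for all $v\in V$. Admissible friction bound. A function $g:\Gamma_3\times\mathbb R\to\mathbb R_+=[0,\infty)$ is an admissible friction bound if: there exists $L_g>0$ such that $|g(x,r_1)-g(x,r_2)|\le L_g|r_1-r_2|$ for all $r_1,r_2\in\mathbb R$ and a.e. $x\in\Gamma_3$; $x\mapsto g(x,r)$ is Lebesgue measurable on $\Gamma_3$ for every $r\in\mathbb R$; and $x\mapsto g(x,0)$ belongs to $L^2(\Gamma_3)$. The dependence on $x$ is omitted in $g(|u|)$. Problem $\mathcal P$ with data $\mu,f_0,f_2,g$: find $u\in V$ such that $$a(u,v-u)+j(u,v)-j(u,u)\ge(f,v-u)_V\quad\text{for all }v\in V,$$ where $a(u,v)=\int_D\mu\,\nabla u\cdot\nabla v\,dx$ and $j(u,v)=\int_{\Gamma_3}g(|u|)\,|v|\,da$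 for $u,v\in V$, and $f\in V$ is defined by $(f,v)_V=\int_Df_0v\,dx+\int_{\Gamma_2}f_2v\,da$ for all $v\in V$. Under assumptions (1)–(5) of the claim this problem has a unique solution. *)

(* Defs.v *)
From HB Require Import structures.
From mathcomp Require Import all_boot all_order all_algebra.
From mathcomp Require Import all_classical all_reals all_analysis.

Set Implicit Arguments.
Unset Strict Implicit.
Unset Printing Implicit Defensive.
Import Order.TTheory GRing.Theory Num.Theory.
Import numFieldNormedType.Exports.

Local Open Scope classical_set_scope.
Local Open Scope ring_scope.

(* Euclidean distance: the norm of the product space R * R is the sup norm,
   for which diameters would not give arc length. *)
Definition edist (R : realType) (x y : R * R) : R :=
  Num.sqrt ((x.1 - y.1) ^+ 2 + (x.2 - y.2) ^+ 2).

Definition ediam (R : realType) (A : set (R * R)) : \bar R :=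
  maxe 0%E (ereal_sup [set (edist p.1 p.2)%:E | p in A `*` A]).

Definition ediam_le (R : realType) (delta : R) (A : set (R * R)) : \bar R :=
  if (ediam A <= delta%:E)%E then ediam A else +oo%E.

(* One-dimensional Hausdorff outer measure. [mu_ext] takes the infimum over
   countable covers by Borel sets of the plane, which is the infimum over all
   countable covers because a set and its closure have the same diameter. *)
Definition hausdorff1 (R : realType) (A : set (R * R)) : \bar R :=
  ereal_sup [set mu_ext (ediam_le delta) A | delta in [set d : R | 0 < d]].

Lemma ediam0 (R : realType) : ediam (set0 : set (R * R)) = 0%E.
Proof.
rewrite /ediam; apply/max_idPl; apply: ge_ereal_sup => _ [p [[]]].
Qed.

Lemma ediam_le_ge0 (R : realType) (d : R) A : (0 <= ediam_le d A)%E.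
Proof.
by rewrite /ediam_le; case: ifP => _; rewrite ?leey // /ediam le_max lexx.
Qed.

Lemma ediam_le0 (R : realType) (d : R) : 0 < d -> ediam_le d set0 = 0%E.
Proof. by move=> d0; rewrite /ediam_le ediam0 lee_fin ltW. Qed.

Lemma hausdorff1_set0 (R : realType) : @hausdorff1 R set0 = 0%E.
Proof.
rewrite /hausdorff1 (_ : [set _ | _ in _] = [set 0%E]) ?ereal_sup1 //.
apply/seteqP; split => [_ [d /= d0 <-]|_ ->].
  by apply: mu_ext0 => [|X]; [exact: ediam_le0 | exact: ediam_le_ge0].
exists 1 => //=.
by apply: mu_ext0 => [|X]; [apply: ediam_le0; exact: ltr01 | exact: ediam_le_ge0].
Qed.

Lemma hausdorff1_ge0 (R : realType) (A : set (R * R)) : (0 <= hausdorff1 A)%E.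
Proof.
apply: (@le_trans _ _ (mu_ext (ediam_le (1 : R)) A)).
  by apply: mu_ext_ge0 => X; exact: ediam_le_ge0.
by apply: ereal_sup_ubound; exists 1 => //=.
Qed.

Lemma le_hausdorff1 (R : realType) :
  {homo @hausdorff1 R : A B / A `<=` B >-> (A <= B)%E}.
Proof.
move=> A B AB; apply: ge_ereal_sup => _ [d d0 <-].
apply: (le_trans (le_mu_ext _ AB)).
by apply: ereal_sup_ubound; exists d.
Qed.

Lemma hausdorff1_sigma_subadditive (R : realType) :
  sigma_subadditive (@hausdorff1 R).
Proof.
move=> F; apply: ge_ereal_sup => _ [d d0 <-].
apply: (le_trans (mu_ext_sigma_subadditive (ediam_le_ge0 d) F)).
apply: lee_nneseries => [i _ _|i _].
  by apply: mu_ext_ge0; exact: ediam_le_ge0.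
by apply: ereal_sup_ubound; exists d.
Qed.

HB.instance Definition _ (R : realType) :=
  isOuterMeasure.Build R (R * R)%type (@hausdorff1 R)
    (hausdorff1_set0 R) (@hausdorff1_ge0 R) (@le_hausdorff1 R)
    (@hausdorff1_sigma_subadditive R).

(* On the Caratheodory sigma-algebra, i.e. completed, so that measurability on
   the boundary is Lebesgue and not only Borel measurability. *)
Definition arc_length (R : realType) :
    set (caratheodory_type (@hausdorff1 R)) -> \bar R := @hausdorff1 R.
Arguments arc_length : clear implicits.

HB.instance Definition _ (R : realType) :=
  isMeasure.Build _ (caratheodory_type (@hausdorff1 R)) R (@arc_length R)
    (@caratheodory_measure0 R _ (@hausdorff1 R))
    (@caratheodory_measure_ge0 R _ (@hausdorff1 R))
    (@caratheodory_measure_sigma_additive R _ (@hausdorff1 R)).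

(* On Borel sets; every class in L^p(D) has a Borel representative. *)
Definition area (R : realType) :
    {measure set (measurableTypeR R * measurableTypeR R) -> \bar R} :=
  (lebesgue_measure \x lebesgue_measure)%E.

Fixpoint is_Ck (R : realType) (k : nat) (f : R * R -> R) : Prop :=
  match k with
  | 0 => continuous f
  | k.+1 => [/\ forall x, differentiable f x,
                is_Ck k ('D_((1, 0) : R * R) f) &
                is_Ck k ('D_((0, 1) : R * R) f)]
  end.

Definition smooth (R : realType) (f : R * R -> R) : Prop :=
  forall k, is_Ck k f.

Definition test_fun (R : realType) (D : set (R * R)) (f : R * R -> R) : Prop :=
  [/\ smooth f, compact (closure [set x | f x != 0]) &
      closure [set x | f x != 0] `<=` D].

Definition bnd (R : realType) (D : set (R * R)) : set (R * R) :=
  closure D `\` interior D.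

(* Near each boundary point D is a strict sublevel set of a smooth function
   without critical points, i.e. D is locally on one side of a smooth curve. *)
Definition smooth_boundary (R : realType) (D : set (R * R)) : Prop :=
  forall p, bnd D p -> exists (U : set (R * R)) (rho : R * R -> R),
    [/\ open U, U p, smooth rho,
        D `&` U = [set x | rho x < 0] `&` U &
        forall x, U x -> ('D_((1, 0) : R * R) rho x != 0) \/
                         ('D_((0, 1) : R * R) rho x != 0)].

Definition smooth_domain (R : realType) (D : set (R * R)) : Prop :=
  [/\ open D, connected D, bounded_set D & smooth_boundary D].

Definition boundary_parts (R : realType) (D G1 G2 G3 : set (R * R)) : Prop :=
  let rel_open (G : set (R * R)) :=
    exists2 U : set (R * R), open U & G = bnd D `&` U in
  [/\ [/\ rel_open G1, rel_open G2 & rel_open G3],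
      [/\ G1 `&` G2 = set0, G1 `&` G3 = set0 & G2 `&` G3 = set0],
      [/\ (@hausdorff1 R).-cara.-measurable (closure G1),
          (@hausdorff1 R).-cara.-measurable (closure G2) &
          (@hausdorff1 R).-cara.-measurable (closure G3)],
      bnd D = closure G1 `|` closure G2 `|` closure G3 &
      (0 < arc_length R G1)%E].

Definition in_L2 (R : realType) d (T : measurableType d)
    (mu : {measure set T -> \bar R}) (A : set T) (f : T -> R) : Prop :=
  f \_ A \in Lfun mu 2%:E.

Definition in_Linfty (R : realType) d (T : measurableType d)
    (mu : {measure set T -> \bar R}) (A : set T) (f : T -> R) : Prop :=
  f \_ A \in Lfun mu +oo%E.

Definition cvg_Lp (R : realType) d (T : measurableType d)
    (mu : {measure set T -> \bar R}) (A : set T) (p : \bar R)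
    (F : nat -> T -> R) (f : T -> R) : Prop :=
  [/\ forall k, (F k) \_ A \in Lfun mu p, f \_ A \in Lfun mu p &
      Lnorm mu p (EFin \o ((F k \- f) \_ A)) @[k --> \oo] --> 0%E].

(* Representatives of a function of H^1(D), of its two weak partial derivatives
   and of its trace; by [is_H1] the last three are determined by the first up
   to null sets. *)
Record h1fun (R : realType) := H1fun {
  hval : R * R -> R; hdx : R * R -> R; hdy : R * R -> R; htrace : R * R -> R }.

Definition hsub (R : realType) (u v : h1fun R) : h1fun R :=
  H1fun (hval u \- hval v) (hdx u \- hdx v) (hdy u \- hdy v)
          (htrace u \- htrace v).

Definition weak_derivative (R : realType) (D : set (R * R)) (e : R * R)
    (v w : R * R -> R) : Prop :=
  forall phi, test_fun D phi ->
    \int[area R]_(x in D) (v x * 'D_e phi x) =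
    - \int[area R]_(x in D) (w x * phi x).

(* The trace operator is the continuous extension to H^1(D) of the restriction
   to the boundary of functions smooth up to the boundary, which are dense in
   H^1(D); [is_trace] is the closure of the graph of this restriction. *)
Definition is_trace (R : realType) (D : set (R * R)) (v : h1fun R) : Prop :=
  exists phi : nat -> R * R -> R,
    [/\ forall k, smooth (phi k),
        cvg_Lp (area R) D 2%:E phi (hval v),
        cvg_Lp (area R) D 2%:E
          (fun k => 'D_((1, 0) : R * R) (phi k)) (hdx v),
        cvg_Lp (area R) D 2%:E
          (fun k => 'D_((0, 1) : R * R) (phi k)) (hdy v) &
        cvg_Lp (arc_length R) (bnd D) 2%:E phi (htrace v)].

Definition is_H1 (R : realType) (D : set (R * R)) (v : h1fun R) : Prop :=
  [/\ [/\ in_L2 (area R) D (hval v), in_L2 (area R) D (hdx v) &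
          in_L2 (area R) D (hdy v)],
      weak_derivative D (1, 0) (hval v) (hdx v),
      weak_derivative D (0, 1) (hval v) (hdy v) &
      is_trace D v].

Definition in_V (R : realType) (D G1 : set (R * R)) (v : h1fun R) : Prop :=
  is_H1 D v /\ {ae arc_length R, forall x, G1 x -> htrace v x = 0}.

Definition innerV (R : realType) (D : set (R * R)) (u v : h1fun R) : R :=
  \int[area R]_(x in D) (hval u x * hval v x) +
  \int[area R]_(x in D) (hdx u x * hdx v x + hdy u x * hdy v x).

Definition normV (R : realType) (D : set (R * R)) (v : h1fun R) : R :=
  Num.sqrt (innerV D v v).

Definition norm_grad (R : realType) (D : set (R * R)) (v : h1fun R) : R :=
  Num.sqrt (\int[area R]_(x in D) (hdx v x ^+ 2 + hdy v x ^+ 2)).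

Definition norm_trace (R : realType) (G : set (R * R)) (v : h1fun R) : R :=
  Num.sqrt (\int[arc_length R]_(x in G) (htrace v x ^+ 2)).

Definition friction_bound (R : realType) (G3 : set (R * R)) (Lg : R)
    (g : R * R -> R -> R) : Prop :=
  [/\ forall x r, G3 x -> 0 <= g x r,
      {ae arc_length R, forall x, G3 x ->
        forall r1 r2, `|g x r1 - g x r2| <= Lg * `|r1 - r2|},
      forall r, measurable_fun (G3 : set (caratheodory_type (@hausdorff1 R)))
                  (g ^~ r) &
      in_L2 (arc_length R) G3 (g ^~ 0)].

Definition viscosity (R : realType) (D : set (R * R)) (mu : R * R -> R)
    (mustar : R) : Prop :=
  [/\ in_Linfty (area R) D mu, 0 < mustar &
      {ae area R, forall x, D x -> mustar <= mu x}].

Definition form_a (R : realType) (D : set (R * R)) (mu : R * R -> R)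
    (u v : h1fun R) : R :=
  \int[area R]_(x in D) (mu x * (hdx u x * hdx v x + hdy u x * hdy v x)).

Definition form_j (R : realType) (G3 : set (R * R)) (g : R * R -> R -> R)
    (u v : h1fun R) : R :=
  \int[arc_length R]_(x in G3) (g x `|htrace u x| * `|htrace v x|).

Definition is_load (R : realType) (D G1 G2 : set (R * R))
    (f0 f2 : R * R -> R) (f : h1fun R) : Prop :=
  in_V D G1 f /\
  forall v, in_V D G1 v ->
    innerV D f v = \int[area R]_(x in D) (f0 x * hval v x) +
                   \int[arc_length R]_(x in G2) (f2 x * htrace v x).

Definition solves_P (R : realType) (D G1 G2 G3 : set (R * R))
    (mu f0 f2 : R * R -> R) (g : R * R -> R -> R) (u : h1fun R) : Prop :=
  in_V D G1 u /\
  exists2 f, is_load D G1 G2 f0 f2 f &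
    forall v, in_V D G1 v ->
      innerV D f (hsub v u) <=
      form_a D mu u (hsub v u) + form_j G3 g u v - form_j G3 g u u.

(* Main.v *)
Require Import Defs.
From HB Require Import structures.
From mathcomp Require Import all_boot all_order all_algebra.
From mathcomp Require Import all_classical all_reals all_analysis.
From mathcomp Require Import measurable_realfun ess_sup_inf lra ring.

Set Implicit Arguments.
Unset Strict Implicit.
Unset Printing Implicit Defensive.
Import Order.TTheory GRing.Theory Num.Theory.
Import numFieldNormedType.Exports.

Local Open Scope classical_set_scope.
Local Open Scope ring_scope.

(** The proof is a direct energy estimate.  Write d for the difference u_n - u.
    Testing the inequality of u with u_n, testing that of u_n with u, and
    adding the two cancels the load, since both inequalities have the same load
    functional on V.  What remains is

      0 <= int_D (mu grad u . grad d - mu_n grad u_n . grad d)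
             + int_G3 (g(|u|) - g(|u_n|)) (|u_n| - |u|).

    If |mu_n - mu| <= e almost everywhere, the first integrand is at most
    (3e/2 - mu_star) |grad d|^2 + (e/2) |grad u|^2: write u_n = u + d and use
    |grad u . grad d| <= (|grad u|^2 + |grad d|^2) / 2.  The second integrand
    is at most Lg d^2, and the trace and Poincare constants bound its integral
    by Lg c0^2 c3^2 int_D |grad d|^2.  Hence ([norm_grad_stability])

      (mu_star - Lg c0^2 c3^2 - 3e/2) |grad d|^2 <= (e/2) |grad u|^2

    in the norm of L^2(D).  By the smallness condition the factor on the left
    stays away from 0 when e is small, so |grad d| tends to 0 with e, and then
    so does d in V.

    Three facts that are taken for granted on paper carry the rest of the text.

    - The friction integrals are finite.  This needs x |-> g(x, |u(x)|) to be
      square integrable on G3, hence measurable.  By the Lipschitz condition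
      g(x, s(x)) is the infimum over rational q of g(x, q) + L |q - s(x)|,
      which gives measurability off a null set
      ([measurable_lipschitz_comp]), and null sets are harmless because arc
      length is complete.

    - G3, which is relatively open in the boundary, is measurable for arc
      length.  Borel sets are Caratheodory measurable for the one-dimensional
      Hausdorff measure because this outer measure is additive on sets at
      positive distance ([hausdorff1_separated],
      [hausdorff1_caratheodory_gt0], [open_caratheodory_hausdorff1]).

    - V is stable under differences ([in_VB]), so that the load and the two
      inequalities with constants c0, c3 apply to d.  For the weak derivatives this needs the products with test
      functions to be integrable ([in_L1_mul_continuous]). *)

(** * Open sets of the plane and area *)

Definition rat_box (R : realType) (q : (rat * rat) * (rat * rat)) :
    set (R * R) :=
  `]ratr q.1.1, ratr q.1.2[%classic `*` `]ratr q.2.1, ratr q.2.2[%classic.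

(** The boxes with rational corners are a countable base of the plane; this is
    what reduces openness to measurability of boxes, both for area and for arc
    length. *)
Lemma open_bigcup_rat_box (R : realType) (U : set (R * R)) : open U ->
  U = \bigcup_q (if `[< rat_box q `<=` U >] then rat_box q else set0).
Proof.
move=> oU; apply/seteqP; split => [x Ux|x [q _]]; last first.
  by case: asboolP => // qU /qU.
have [[A B] /= [nA nB] ABU] : nbhs x U by exact: open_nbhs_nbhs.
have rat_itv (y : R) (C : set R) : nbhs y C ->
    exists q : rat * rat, `]ratr q.1, ratr q.2[%classic y /\
      `]ratr q.1, ratr q.2[%classic `<=` C.
  move=> /nbhs_ballP [e /= e0 eC].
  have /rat_in_itvoo[a] : y - e < y by rewrite ltrBlDr ltrDl.
  rewrite in_itv /= => /andP[ya ay].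
  have /rat_in_itvoo[b] : y < y + e by rewrite ltrDl.
  rewrite in_itv /= => /andP[yb be].
  exists (a, b); split => /=; first by rewrite in_itv /= ay yb.
  move=> z /=; rewrite in_itv /= => /andP[az zb]; apply: eC.
  rewrite /ball /= ltr_norml; apply/andP; split; lra.
have [q1 [q1x q1A]] := rat_itv _ _ nA.
have [q2 [q2x q2B]] := rat_itv _ _ nB.
exists (q1, q2) => //; case: asboolP => [_|[]]; first by split.
by move=> z [z1 z2]; apply: ABU; split; [exact: q1A | exact: q2B].
Qed.

Lemma open_measurable_prod (R : realType) (U : set (R * R)) : open U ->
  measurable (U : set (measurableTypeR R * measurableTypeR R)).
Proof.
move=> /open_bigcup_rat_box ->; apply: countable_bigcupT_measurable => // q.
by case: ifP => _ //; apply: measurableX; exact: measurable_itv.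
Qed.

Lemma continuous_measurable_prod (R : realType) (f : R * R -> R) :
  continuous f ->
  measurable_fun [set: measurableTypeR R * measurableTypeR R] f.
Proof.
move=> /continuousP cf.
apply: (measurability _ (@RGenOpens.measurableE R)) => _ [_ [a [b ->] <-]].
rewrite setTI; apply: open_measurable_prod; apply: cf; exact: interval_open.
Qed.

(** * Borel sets are measurable for arc length *)

(** A set of diameter less than [e] cannot meet both [A] and [B].  So a cover
    of the union by sets of small diameter splits into a cover of [A] and a
    cover of [B] with no set in common.  The separation is measured by a
    1-Lipschitz function rather than by the distance of the two sets, which is
    the form that suits level sets. *)
Lemma hausdorff1_separated (R : realType) (f : R * R -> R) (e : R)
    (A B : set (R * R)) : 0 < e ->
  (forall x y, `|f x - f y| <= Defs.edist x y) ->
  (forall x y, A x -> B y -> e <= `|f x - f y|) ->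
  (hausdorff1 A + hausdorff1 B <= hausdorff1 (A `|` B))%E.
Proof.
move=> e0 flip AB.
have le_ediam (S : set (R * R)) x y : S x -> S y ->
    ((Defs.edist x y)%:E <= ediam S)%E.
  move=> Sx Sy; rewrite /ediam le_max; apply/orP; right.
  by apply: ereal_sup_ubound; exists (x, y).
have sep d : 0 < d -> d < e ->
    (mu_ext (@ediam_le R d) A + mu_ext (@ediam_le R d) B <=
     mu_ext (@ediam_le R d) (A `|` B))%E.
  move=> d0 de; apply: le_ereal_inf_tmp => _ [F [mF ABF] <-].
  (* The part of the cover that meets S. *)
  pose hit (S : set (R * R)) k : set (R * R) :=
    if `[< F k `&` S !=set0 >] then F k else set0.
  have le_hit S : S `<=` A `|` B ->
      (mu_ext (@ediam_le R d) S <= \sum_(0 <= k <oo) ediam_le d (hit S k))%E.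
    move=> SAB; apply: ereal_inf_lbound; exists (hit S) => //.
    split => [k|x Sx].
      by rewrite /hit; case: ifP.
    have [k _ Fkx] := ABF _ (SAB _ Sx).
    by exists k => //; rewrite /hit; case: asboolP => // -[]; exists x.
  apply: (@le_trans _ _ (\sum_(0 <= k <oo) ediam_le d (hit A k) +
                         \sum_(0 <= k <oo) ediam_le d (hit B k))%E).
    by apply: leeD; apply: le_hit => x; [left|right].
  rewrite -nneseriesD; [|by move=> *; exact: ediam_le_ge0..].
  apply: lee_nneseries => [k _ _|k _].
    by rewrite adde_ge0 // ediam_le_ge0.
  rewrite /hit; case: asboolP => [[x [Fx Ax]]|_]; last first.
    rewrite ediam_le0 // add0e; case: ifP => // _.
    by rewrite ediam_le0 ?ediam_le_ge0.
  case: asboolP => [[y [Fy By]]|_]; last by rewrite ediam_le0 // adde0.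
  rewrite /ediam_le ifF ?leey //; apply/negbTE; rewrite -ltNge.
  apply: lt_le_trans (le_ediam _ _ _ Fx Fy); rewrite lte_fin.
  by apply: lt_le_trans de _; apply: le_trans (AB _ _ Ax By) (flip _ _).
(* Smaller diameters leave fewer covers. *)
have le_mu S d d' : 0 < d' -> d' <= d ->
    (mu_ext (@ediam_le R d) S <= mu_ext (@ediam_le R d') S)%E.
  move=> d'0 dd'; apply: le_ereal_inf_tmp => _ [F mF <-].
  apply: ge_ereal_inf; exists (\sum_(0 <= k <oo) ediam_le d (F k))%E.
    by exists F.
  apply: lee_nneseries => [k _ _|k _]; first exact: ediam_le_ge0.
  rewrite /ediam_le; case: ifP => Fd; case: ifP => // Fd'; rewrite ?leey //.
  by move: Fd; rewrite (le_trans Fd') // lee_fin.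
have muge0 d S : (0 <= mu_ext (@ediam_le R d) S)%E.
  by apply: mu_ext_ge0 => X; exact: ediam_le_ge0.
(* The two suprema defining the Hausdorff measures of A and B are taken
   independently, so different bounds on the diameters must be allowed. *)
have step d d' : 0 < d -> 0 < d' ->
   (mu_ext (@ediam_le R d) A + mu_ext (@ediam_le R d') B <=
      hausdorff1 (A `|` B))%E.
  move=> d0 d'0; pose m := Num.min (Num.min d d') (e / 2).
  have m0 : 0 < m by rewrite !lt_min d0 d'0 divr_gt0.
  apply: (@le_trans _ _
    (mu_ext (@ediam_le R m) A + mu_ext (@ediam_le R m) B)%E).
    by apply: leeD; apply: le_mu => //; rewrite /m !ge_min lexx ?orbT.
  apply: (le_trans (sep _ m0 _)); last by apply: ereal_sup_ubound; exists m.
  by rewrite /m gt_min ltr_pdivrMr // ltr_pMr // ltr1n orbT.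
have [->|ABfin] := eqVneq (hausdorff1 (A `|` B)) +oo%E; first by rewrite leey.
have fin x : (0 <= x)%E -> (x <= hausdorff1 (A `|` B))%E -> x \is a fin_num.
  move=> x0 xAB; rewrite ge0_fin_numE //.
  by apply: le_lt_trans xAB _; rewrite ltey.
have Afin : hausdorff1 A \is a fin_num.
  by apply: fin; [exact: hausdorff1_ge0 | exact/le_hausdorff1/subsetUl].
rewrite -leeBrDl //; apply: ge_ereal_sup => _ [d' d'0 <-].
have d'fin : mu_ext (@ediam_le R d') B \is a fin_num.
  by apply: fin => //; apply: le_trans (step 1 d' ltr01 d'0); exact: leeDr.
rewrite leeBrDl // -leeBrDr //; apply: ge_ereal_sup => _ [d d0 <-].
by rewrite leeBrDr //; exact: step.
Qed.

(** Caratheodory's criterion for metric outer measures.  The set [T n], where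
    [f] exceeds [r n], is separated from the set where [f] is nonpositive, so
    the measures of the two add up to at most that of [X]; it remains to see
    that the measure of [T n] tends to that of its union.  The shells [S n]
    between consecutive levels make up the difference, and
    [h (T n) + h (S n.+1) <= h (T n.+2)] because [T n] and [S n.+1] are
    separated by the shell [S n].  The measures of the shells are therefore
    summable by telescoping, and their tails tend to 0. *)
Lemma hausdorff1_caratheodory_gt0 (R : realType) (f : R * R -> R) :
  (forall x y, `|f x - f y| <= Defs.edist x y) ->
  (@hausdorff1 R).-caratheodory [set x | 0 < f x].
Proof.
move=> flip; apply: le_caratheodory_measurable => X.
set P := [set x | 0 < f x].
change (hausdorff1 (X `&` P) + hausdorff1 (X `&` ~` P) <= hausdorff1 X)%E.
have [->|Xfin] := eqVneq (hausdorff1 X) +oo%E; first by rewrite leey.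
have fin Y : Y `<=` X -> hausdorff1 Y \is a fin_num.
  move=> YX; rewrite ge0_fin_numE ?hausdorff1_ge0 //.
  by apply: le_lt_trans (le_hausdorff1 YX) _; rewrite ltey.
pose h (Y : set (R * R)) : R := fine (hausdorff1 Y).
have hE Y : Y `<=` X -> hausdorff1 Y = (h Y)%:E.
  by move=> YX; rewrite fineK ?fin.
have h_sep e Y Z : 0 < e -> Y `<=` X -> Z `<=` X ->
    (forall x y, Y x -> Z y -> e <= `|f x - f y|) -> h Y + h Z <= h (Y `|` Z).
  move=> e0 YX ZX YZ; rewrite -lee_fin EFinD -!hE //; last by rewrite subUset.
  exact: hausdorff1_separated e0 flip YZ.
have h_le Y Z : Z `<=` X -> Y `<=` Z -> h Y <= h Z.
  move=> ZX YZ; rewrite -lee_fin -!hE //; first exact: le_hausdorff1.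
  exact: subset_trans ZX.
pose r n : R := n.+1%:R^-1.
have r0 n : 0 < r n by rewrite invr_gt0.
have rS n : r n.+1 < r n by rewrite ltf_pV2 ?posrE // ltr_nat.
pose T n := X `&` [set x | r n < f x].
pose S n := X `&` [set x | r n.+1 < f x <= r n].
have TX n : T n `<=` X by move=> x [].
have SX n : S n `<=` X by move=> x [].
have T_step n : h (T n) + h (S n.+1) <= h (T n.+2).
  have gap : 0 < r n - r n.+1 by rewrite subr_gt0.
  apply: le_trans (h_sep _ _ _ gap _ _ _) (h_le _ _ _ _) => //.
    move=> x y [_ /= fx] [_ /= /andP[_ fy]].
    rewrite (le_trans _ (ler_norm _)) //; lra.
  move=> x [[Xx /= fx]|[Xx /= /andP[fx _]]]; split => //=.
  by apply: lt_trans fx; apply: lt_trans (rS n); exact: rS.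
pose L := sup (range (h \o T)).
have supT : has_sup (range (h \o T)).
  split; first by exists (h (T 0%N)); exists 0%N.
  by exists (h X) => _ [n _ <-] /=; exact: h_le.
have T_L n : h (T n) <= L by apply: sup_upper_bound => //; exists n.
have L_le : L + h (X `&` ~` P) <= h X.
  rewrite -lerBrDr; apply: sup_le_ub => [|_ [n _ <-] /=].
    by exists (h (T 0%N)); exists 0%N.
  rewrite lerBrDr.
  apply: le_trans (h_sep _ _ _ (r0 n) _ _ _) (h_le _ _ _ _) => //.
  - move=> x y [_ /= fx] [_ /= /negP]; rewrite -leNgt => fy.
    rewrite (le_trans _ (ler_norm _)) //; lra.
  - by move=> x [] [].
have sumS n N : \sum_(0 <= k < N) h (S (n.+1 + k)%N) <=
    h (T (n.+1 + N)%N) + h (T (n + N)%N) - h (T n.+1) - h (T n).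
  elim: N => [|N ih]; first by rewrite big_nil !addn0; lra.
  rewrite big_nat_recr //= !addnS !addSn.
  by have := T_step (n + N)%N; move: ih; rewrite !addSn; lra.
suff le_L : h (X `&` P) <= L.
  rewrite !hE //.
  by rewrite -EFinD lee_fin; lra.
apply/ler_addgt0Pr => e e0.
have e2 : 0 < e / 2 by rewrite divr_gt0.
(* From this level on, the sums of the shells are at most
   L - h (T n.+1) + (L - h (T n)), which is at most 2 * (e / 2). *)
have [_ [n _ <-] /= Tn] := sup_adherent e2 supT.
have cover : X `&` P `<=`
    T n.+1 `|` \bigcup_k S (n.+1 + k)%N.
  move=> x [Xx /= fx]; have [k] := ltr_add_invr fx; rewrite add0r => rk.
  have [Tx|Tx] := ltP (r n.+1) (f x); first by left.
  right; have exk : exists j, r (n.+1 + j)%N < f x.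
    exists k; apply: le_lt_trans rk.
    by rewrite lef_pV2 ?posrE // ler_nat ltnS leq_addl.
  case: (ex_minnP exk) => -[|j] rj minj.
    by move: rj; rewrite addn0 ltNge Tx.
  exists j => //; split => //=; rewrite -addnS rj /= leNgt.
  by apply/negP => /minj; rewrite ltnn.
rewrite -lee_fin -hE; last by move=> x [].
apply: le_trans (le_hausdorff1 cover) _.
apply: le_trans (outer_measureU2 _ _ _) _.
apply: (@le_trans _ _ (hausdorff1 (T n.+1) +
    \sum_(0 <= k <oo) hausdorff1 (S (n.+1 + k)%N))%E).
  by apply: leeD => //; exact: hausdorff1_sigma_subadditive.
rewrite (hE (T n.+1)) //.
have sum_le : (\sum_(0 <= k <oo) hausdorff1 (S (n.+1 + k)%N) <=
    (L - h (T n.+1) + (L - h (T n)))%:E)%E.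
  apply: lime_le.
    by apply: is_cvg_nneseries => k _ _; exact: hausdorff1_ge0.
  apply: nearW => N; under eq_bigr do rewrite hE //.
  rewrite sumEFin lee_fin (le_trans (sumS _ _)) //.
  by have := T_L (n.+1 + N)%N; have := T_L (n + N)%N; lra.
apply: le_trans (leeD (lexx _) sum_le) _.
rewrite -EFinD lee_fin; have := T_L n.+1; rewrite -/L in Tn; lra.
Qed.

(** A box is the intersection of four half-planes, each of which is the set
    where a 1-Lipschitz function (a coordinate, up to sign and a constant) is
    positive. *)
Lemma open_caratheodory_hausdorff1 (R : realType) (U : set (R * R)) :
  open U -> (@hausdorff1 R).-cara.-measurable U.
Proof.
move=> /open_bigcup_rat_box ->.
have lip1 (x y : R * R) : `|x.1 - y.1| <= Defs.edist x y.
  by rewrite -sqrtr_sqr ler_wsqrtr // lerDl sqr_ge0.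
have lip2 (x y : R * R) : `|x.2 - y.2| <= Defs.edist x y.
  by rewrite -sqrtr_sqr ler_wsqrtr // lerDr sqr_ge0.
have half (f : R * R -> R) : (forall x y, `|f x - f y| <= Defs.edist x y) ->
    (@hausdorff1 R).-cara.-measurable [set x | 0 < f x].
  exact: hausdorff1_caratheodory_gt0.
have gt1 c : (@hausdorff1 R).-cara.-measurable [set x | 0 < x.1 - c].
  apply: half => x y; rewrite (_ : _ - _ = x.1 - y.1) ?lip1 //; lra.
have lt1 c : (@hausdorff1 R).-cara.-measurable [set x | 0 < c - x.1].
  apply: half => x y; rewrite distrC (_ : _ - _ = x.1 - y.1) ?lip1 //; lra.
have gt2 c : (@hausdorff1 R).-cara.-measurable [set x | 0 < x.2 - c].
  apply: half => x y; rewrite (_ : _ - _ = x.2 - y.2) ?lip2 //; lra.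
have lt2 c : (@hausdorff1 R).-cara.-measurable [set x | 0 < c - x.2].
  apply: half => x y; rewrite distrC (_ : _ - _ = x.2 - y.2) ?lip2 //; lra.
apply: (@countable_bigcupT_measurable _
  (caratheodory_type (@hausdorff1 R))) => // q.
case: ifP => _; last exact: measurable0.
rewrite (_ : rat_box q = ([set x | 0 < x.1 - ratr q.1.1] `&`
  [set x | 0 < ratr q.1.2 - x.1]) `&` ([set x | 0 < x.2 - ratr q.2.1] `&`
  [set x | 0 < ratr q.2.2 - x.2])).
  exact: (measurableI _ _ (measurableI _ _ (gt1 _) (lt1 _))
                          (measurableI _ _ (gt2 _) (lt2 _))).
apply/seteqP; split => x; rewrite /rat_box /= !in_itv /= !subr_gt0.
  by move=> [/andP[-> ->] /andP[-> ->]].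
by move=> [[-> ->] [-> ->]].
Qed.

Lemma rel_open_bnd_measurable (R : realType) (D G U : set (R * R)) :
  open U -> G = bnd D `&` U -> (@hausdorff1 R).-cara.-measurable G.
Proof.
move=> oU ->; have mC (C : set (R * R)) : closed C ->
    (@hausdorff1 R).-cara.-measurable C.
  move=> cC; rewrite -(setCK C); apply: measurableC.
  exact/open_caratheodory_hausdorff1/closed_openC.
have mbnd : (@hausdorff1 R).-cara.-measurable (bnd D).
  apply: mC; apply: closedI; first exact: closed_closure.
  exact/open_closedC/open_interior.
exact: (measurableI _ _ mbnd (open_caratheodory_hausdorff1 oU)).
Qed.

(** * Integrable functions on a set *)

Section functions_on_a_set.
Context d (T : measurableType d) (R : realType).
Variables (mu : {measure set T -> \bar R}) (A : set T).
Implicit Types f g h : T -> R.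

(** Integrability of the extension by zero, in line with [in_L2]: in this form
    the calculus below does not ask for [A] to be measurable. *)
Definition in_L1 f := mu.-integrable [set: T] (EFin \o f \_ A).

Lemma restrictD f g : (f \+ g) \_ A = f \_ A \+ g \_ A.
Proof.
by apply/funext => x; rewrite /= !patchE; case: ifP => // _; rewrite addr0.
Qed.

Lemma restrictN f : (\- f) \_ A = \- (f \_ A).
Proof.
by apply/funext => x; rewrite /= !patchE; case: ifP => // _; rewrite oppr0.
Qed.

Lemma restrictB f g : (f \- g) \_ A = f \_ A \- g \_ A.
Proof. by rewrite (_ : f \- g = f \+ \- g) // restrictD restrictN. Qed.

Lemma restrictM f g : (f \* g) \_ A = f \_ A \* g \_ A.
Proof.
by apply/funext => x; rewrite /= !patchE; case: ifP => // _; rewrite mulr0.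
Qed.

Lemma restrictZ k f : (k \*o f) \_ A = k \*o (f \_ A).
Proof.
by apply/funext => x; rewrite /= !patchE; case: ifP => // _; rewrite mulr0.
Qed.

Lemma measurable_in_L1 f : in_L1 f -> measurable_fun [set: T] (f \_ A).
Proof. by move=> /integrableP[/measurable_EFinP]. Qed.

Lemma measurable_in_L2 f : in_L2 mu A f -> measurable_fun [set: T] (f \_ A).
Proof. by rewrite /in_L2 inE => /andP[]; rewrite inE. Qed.

Lemma in_L1D f g : in_L1 f -> in_L1 g -> in_L1 (f \+ g).
Proof.
move=> fi gi; rewrite /in_L1 restrictD.
exact: (integrableD measurableT fi gi).
Qed.

Lemma in_L1B f g : in_L1 f -> in_L1 g -> in_L1 (f \- g).
Proof.
move=> fi gi; rewrite /in_L1 restrictB.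
exact: (integrableB measurableT fi gi).
Qed.

Lemma in_L1Z k f : in_L1 f -> in_L1 (k \*o f).
Proof.
by move=> fi; rewrite /in_L1 restrictZ; exact: (integrableZl measurableT k fi).
Qed.

Lemma in_L2M f g : in_L2 mu A f -> in_L2 mu A g -> in_L1 (f \* g).
Proof.
move=> fi gi; rewrite /in_L1 restrictM; apply/Lfun1_integrable.
exact: Lfun2_mul_Lfun1.
Qed.

Lemma in_L2D f g : in_L2 mu A f -> in_L2 mu A g -> in_L2 mu A (f \+ g).
Proof.
move=> fi gi; rewrite /in_L2 restrictD.
exact: (Lfun_addr_closed mu (lee1n 2)).2 _ _ fi gi.
Qed.

Lemma in_L2B f g : in_L2 mu A f -> in_L2 mu A g -> in_L2 mu A (f \- g).
Proof.
move=> fi gi; rewrite (_ : f \- g = f \+ \- g) //; apply: in_L2D => //.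
by rewrite /in_L2 restrictN; exact: Lfun_oppr_closed gi.
Qed.

Lemma Rintegral_onD f g : in_L1 f -> in_L1 g ->
  \int[mu]_(x in A) (f x + g x) = \int[mu]_(x in A) f x + \int[mu]_(x in A) g x.
Proof.
move=> fi gi; rewrite !(Rintegral_mkcond _ A) -RintegralD //.
by congr Rintegral; exact: restrictD.
Qed.

Lemma Rintegral_onB f g : in_L1 f -> in_L1 g ->
  \int[mu]_(x in A) (f x - g x) = \int[mu]_(x in A) f x - \int[mu]_(x in A) g x.
Proof.
move=> fi gi; rewrite !(Rintegral_mkcond _ A) -RintegralB //.
by congr Rintegral; exact: restrictB.
Qed.

Lemma Rintegral_onZ k f : in_L1 f ->
  \int[mu]_(x in A) (k * f x) = k * \int[mu]_(x in A) f x.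
Proof.
move=> fi; rewrite !(Rintegral_mkcond _ A) -RintegralZl //.
by congr Rintegral; exact: restrictZ.
Qed.

Lemma ae_restrict (P : R -> R -> Prop) f g : P 0 0 ->
  {ae mu, forall x, A x -> P (f x) (g x)} ->
  {ae mu, forall x, P ((f \_ A) x) ((g \_ A) x)}.
Proof.
move=> P0; apply: filterS => x fg; rewrite !patchE.
by case: ifPn => // /set_mem/fg.
Qed.

(** The difference [g - f] agrees almost everywhere with its positive part,
    whose integral is visibly nonnegative. *)
Lemma ae_le_Rintegral_on f g : in_L1 f -> in_L1 g ->
  {ae mu, forall x, A x -> f x <= g x} ->
  \int[mu]_(x in A) f x <= \int[mu]_(x in A) g x.
Proof.
move=> fi gi /(ae_restrict (P := fun a b => a <= b) (lexx 0)) fg.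
rewrite -subr_ge0 -Rintegral_onB // Rintegral_mkcond restrictB.
have mfg : measurable_fun [set: T] (EFin \o (g \_ A \- f \_ A)).
  by apply/measurable_EFinP/measurable_funB; exact: measurable_in_L1.
rewrite /Rintegral (@ae_eq_integral _ _ _ _ _
  (fun x => maxe 0%E ((g \_ A \- f \_ A) x)%:E)) //.
- by apply: fine_ge0; apply: integral_ge0 => x _; rewrite le_max lexx.
- by apply: measurable_maxe => //; exact: measurable_cst.
- move: fg; apply: filterS => x fgx _ /=.
  by rewrite (max_idPr _) // lee_fin subr_ge0.
Qed.

Lemma in_L1_dominated f g : measurable_fun [set: T] (f \_ A) -> in_L1 g ->
  {ae mu, forall x, A x -> `|f x| <= `|g x|} -> in_L1 f.
Proof.
move=> mf gi fg; apply/integrableP; split; first exact/measurable_EFinP.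
have /integrableP[mg] := gi; apply: le_lt_trans.
apply: ae_ge0_le_integral => //=.
- by apply/measurable_EFinP; exact: measurableT_comp.
- apply/measurable_EFinP; apply: measurableT_comp => //.
  exact/measurable_EFinP.
move: fg; apply: filterS => x fgx _; rewrite lee_fin !patchE.
by case: ifPn => // /set_mem/fgx.
Qed.

Lemma in_L2_dominated f g : measurable_fun [set: T] (f \_ A) -> in_L2 mu A g ->
  {ae mu, forall x, A x -> `|f x| <= `|g x|} -> in_L2 mu A f.
Proof.
move=> mf gi fg; rewrite /in_L2 inE; apply/andP; split; first by rewrite inE.
move: gi; rewrite /in_L2 !inE /finite_norm /= => /andP[]; rewrite !inE /= => mg.
apply: le_lt_trans; rewrite unlock gt0_ler_poweR ?in_itv /= ?leey ?andbT//.
- by apply: integral_ge0 => x _; rewrite lee_fin powR_ge0.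
- by apply: integral_ge0 => x _; rewrite lee_fin powR_ge0.
have mpow h : measurable_fun [set: T] h ->
    measurable_fun [set: T] (fun x => `|(h x)%:E| `^ 2)%E.
  move=> mh; apply/measurable_EFinP.
  apply: (@measurableT_comp _ _ _ _ _ _ (@powR R ^~ 2)) => //.
  exact: measurableT_comp.
apply: ae_ge0_le_integral => //=; [exact: mpow|exact: mpow|].
move: fg; apply: filterS => x fgx _; rewrite lee_fin ge0_ler_powR ?nnegrE //.
by rewrite !patchE; case: ifPn => // /set_mem/fgx.
Qed.

Lemma in_L2_norm f : in_L2 mu A f -> in_L2 mu A (fun x => `|f x|).
Proof.
move=> fi; apply: (in_L2_dominated _ fi).
  rewrite (restrict_normr A f).
  by apply: measurableT_comp => //; exact: measurable_in_L2.
by apply: aeW => x _; rewrite normr_id.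
Qed.

(** On a space of measure zero the norm is 0 by convention, but then every
    property holds almost everywhere. *)
Lemma Lnorm_oo_le (f : T -> R) (e : R) : 0 <= e ->
  ('N[mu]_+oo%E[EFin \o f] <= e%:E)%E -> {ae mu, forall x, `|f x| <= e}.
Proof.
move=> e0; rewrite unlock; case: ifPn => [_ /ess_supP fe|].
  by move: fe; apply: filterS => x; rewrite /= lee_fin.
rewrite -leNgt measure_le0 => /eqP muT _; exists setT; split => //.
Qed.

Lemma in_Linfty_bounded f : in_Linfty mu A f ->
  exists2 M, 0 <= M & {ae mu, forall x, A x -> `|f x| <= M}.
Proof.
rewrite /in_Linfty inE => /andP[_]; rewrite inE /= /finite_norm => fle.
have fge := Lnorm_ge0 mu +oo%E (EFin \o f \_ A).
have ffin : 'N[mu]_+oo%E[EFin \o f \_ A]%E \is a fin_num.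
  by rewrite ge0_fin_numE.
exists (fine ('N[mu]_+oo%E[EFin \o f \_ A]%E)); first exact: fine_ge0.
have := @Lnorm_oo_le (f \_ A) _ (fine_ge0 fge).
rewrite fineK // => /(_ (lexx _)).
by apply: filterS => x + Ax; rewrite patchE mem_set.
Qed.

Lemma in_LinftyM f g : in_Linfty mu A f -> in_L1 g -> in_L1 (f \* g).
Proof.
move=> fi gi; have [M M0 fM] := in_Linfty_bounded fi.
apply: (@in_L1_dominated _ (M \*o g)).
- rewrite restrictM; apply: measurable_funM; last exact: measurable_in_L1.
  by move: fi; rewrite /in_Linfty inE => /andP[]; rewrite inE.
- exact: in_L1Z.
- move: fM; apply: filterS => x fM Ax.
  by rewrite /= !normrM ler_wpM2r // (ger0_norm M0) fM.
Qed.

End functions_on_a_set.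

Lemma in_L2_subset d (T : measurableType d) (R : realType)
    (mu : {measure set T -> \bar R}) (A B : set T) (f : T -> R) :
  measurable B -> B `<=` A -> in_L2 mu A f -> in_L2 mu B f.
Proof.
move=> mB BA fA; have fBA : f \_ B = (f \_ A) \_ B.
  by rewrite -patch_setI setIidl.
have mfB : measurable_fun [set: T] (f \_ B).
  rewrite fBA; apply/(measurable_restrictT _ mB).
  by apply: measurable_funS (measurable_in_L2 fA).
rewrite /in_L2 -[f \_ B](patch_setT (fun=> 0)).
apply: (@in_L2_dominated _ _ _ _ _ _ (f \_ A)); rewrite ?patch_setT //.
  by rewrite /in_L2 patch_setT.
apply: aeW => x _; rewrite fBA [X in `|X| <= _]patchE.
by case: ifP => // _; rewrite normr0.
Qed.

(** * The friction term *)

(** A function of Caratheodory type composed with a measurable function is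
    measurable.  Where [g x] is [L]-Lipschitz, [g x (s x) < a] holds exactly
    when [g x q + L * `|q - s x| < a] for some rational [q], so the sublevel
    set is a countable union of sublevel sets of measurable functions.
    Completeness disposes of the set where the Lipschitz condition fails. *)
Lemma measurable_lipschitz_comp d (T : measurableType d) (R : realType)
    (mu : {measure set T -> \bar R}) (G : set T) (g : T -> R -> R)
    (s : T -> R) (L : R) :
  measure_is_complete mu -> measurable G -> 0 <= L ->
  (forall r, measurable_fun G (g ^~ r)) -> measurable_fun G s ->
  {ae mu, forall x, G x -> forall r1 r2,
    `|g x r1 - g x r2| <= L * `|r1 - r2|} ->
  measurable_fun G (fun x => g x (s x)).
Proof.
move=> muc mG L0 mg ms glip.
pose N := ~` [set x | G x -> forall r1 r2,
  `|g x r1 - g x r2| <= L * `|r1 - r2|].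
have negl S : S `<=` N -> measurable S.
  by move=> SN; apply: muc; apply: negligibleS glip.
have mN : measurable N by exact: negl.
have mE : measurable (G `\` N) by exact: measurableD.
rewrite (_ : G = (G `\` N) `|` (G `&` N)); last first.
  by rewrite setDE -setIUr setUC setUv setIT.
apply/measurable_funU => //; first exact: measurableI.
split; last by move=> _ Y _; apply: negl => x [[]].
apply: (measurability _ (RGenInftyO.measurableE R)) => _ [_ [a ->] <-].
pose h (q : rat) x := g x (ratr q) + L * `|ratr q - s x|.
have mh q : measurable_fun (G `\` N) (h q).
  apply: (@measurable_funS _ _ _ _ G) => //.
  apply: measurable_funD; first exact: mg.
  apply: measurable_funM => //.
  by apply: measurableT_comp => //; apply: measurable_funB.
rewrite (_ : _ `&` _ = \bigcup_q ((G `\` N) `&` h q @^-1` `]-oo, a[%classic)).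
  by apply: bigcupT_measurable_rat => q; apply: mh => //; exact: measurable_itv.
apply/seteqP; split => x; last first.
  move=> [q _ [[Gx /contrapT /(_ Gx) xlip]]] /=; rewrite !in_itv /= /h => hq.
  split; first by split => //; apply; exact: (fun _ => xlip).
  apply: le_lt_trans hq; rewrite -lerBlDl [`|_ - s x|]distrC.
  exact: le_trans (ler_norm _) (xlip _ _).
move=> [[Gx Nx]] /=; rewrite in_itv /= => gxa.
have /(_ Gx) xlip := contrapT Nx.
have L1 : 0 < 2 * L + 1 by lra.
(* Moving from s x to a point q at distance t changes g x q + L * `|q - s x|
   by at most 2 * L * t; the summand 1 keeps the denominator positive. *)
have [q] : exists q, s x < ratr q < s x + (a - g x (s x)) / (2 * L + 1).
  have /rat_in_itvoo[q] : s x < s x + (a - g x (s x)) / (2 * L + 1).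
    by rewrite ltrDl divr_gt0 // subr_gt0.
  by rewrite in_itv /=; exists q.
move=> /andP[sq qs]; exists q => //; split => //=; rewrite in_itv /= /h.
have : (ratr q - s x) * (2 * L + 1) < a - g x (s x).
  by rewrite -ltr_pdivlMr // ltrBlDl.
have := le_trans (ler_norm _) (xlip (ratr q) (s x)).
by rewrite gtr0_norm ?subr_gt0 //; nra.
Qed.

(** By the Lipschitz condition [g x `|t x|] is dominated by
    [g x 0 + Lg * `|t x|], which is square integrable. *)
Lemma in_L2_friction (R : realType) (G3 : set (R * R)) (Lg : R)
    (g : R * R -> R -> R) (t : R * R -> R) :
  (@hausdorff1 R).-cara.-measurable G3 -> 0 <= Lg -> friction_bound G3 Lg g ->
  in_L2 (arc_length R) G3 t ->
  in_L2 (arc_length R) G3 (fun x => g x `|t x|).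
Proof.
move=> mG Lg0 [gpos glip mg g0] tL2.
have mt : measurable_fun (G3 : set (caratheodory_type (@hausdorff1 R))) t.
  exact/(measurable_restrictT _ mG)/(measurable_in_L2 tL2).
have mat : measurable_fun (G3 : set (caratheodory_type (@hausdorff1 R)))
    (fun x => `|t x|) by exact: measurableT_comp.
have atL2 : in_L2 (arc_length R) G3 (fun x => Lg * `|t x|).
  apply: (@in_L2_dominated _ _ _ (arc_length R) G3 _ (Lg \o* t)).
  - by apply/(measurable_restrictT _ mG); apply: measurable_funM.
  - rewrite /in_L2 (_ : _ \_ G3 = Lg \o* (t \_ G3)).
      by apply: Lfun_scale => //; rewrite ler1n.
    by apply/funext => x; rewrite /= !patchE; case: ifP => // _; rewrite mul0r.
  - by apply: aeW => x _; rewrite /= !normrM normr_id mulrC.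
have boundL2 := in_L2D g0 atL2.
apply: (@in_L2_dominated _ _ _ (arc_length R) G3 _ _ _ boundL2).
- apply/(measurable_restrictT _ mG).
  apply: (measurable_lipschitz_comp _ _ Lg0 mg mat glip) => //.
  exact: measure_is_complete_caratheodory.
- move: glip; apply: (@filterS _ _ (ae_filter_ringOfSetsType (arc_length R))).
  move=> x glip Gx.
  have := le_trans (ler_norm _) (glip Gx `|t x| 0).
  rewrite subr0 normr_id => gx.
  rewrite ger0_norm ?gpos // (le_trans _ (ler_norm _)) //= -lerBlDl //.
Qed.

(** * Differences in V *)

Lemma derive_fctB (R : realType) (f g : R * R -> R) v :
  (forall x, differentiable f x) -> (forall x, differentiable g x) ->
  'D_v (f \- g) = 'D_v f \- 'D_v g.
Proof.
by move=> df dg; apply/funext => x; apply: deriveB; exact: diff_derivable.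
Qed.

Lemma is_CkB (R : realType) k (f g : R * R -> R) :
  is_Ck k f -> is_Ck k g -> is_Ck k (f \- g).
Proof.
elim: k f g => [|k ih] f g /= => [cf cg x|[df f1 f2] [dg g1 g2]].
  by apply: cvgB; [exact: cf | exact: cg].
split; [|by rewrite derive_fctB //; exact: ih..].
by move=> x; exact: differentiableB.
Qed.

Lemma smoothB (R : realType) (f g : R * R -> R) :
  smooth f -> smooth g -> smooth (f \- g).
Proof. by move=> sf sg k; exact: is_CkB. Qed.

Lemma smooth_deriveB (R : realType) (f g : R * R -> R) v :
  smooth f -> smooth g -> 'D_v (f \- g) = 'D_v f \- 'D_v g.
Proof. by move=> /(_ 1%N)[df _ _] /(_ 1%N)[dg _ _]; exact: derive_fctB. Qed.

Lemma cvg_LpB d (T : measurableType d) (R : realType)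
    (mu : {measure set T -> \bar R}) (A : set T) (F G : nat -> T -> R)
    (f g : T -> R) :
  cvg_Lp mu A 2%:E F f -> cvg_Lp mu A 2%:E G g ->
  cvg_Lp mu A 2%:E (fun k => F k \- G k) (f \- g).
Proof.
move=> [Fk fL2 Ff] [Gk gL2 Gg]; split => [k||].
- exact: in_L2B (Fk k) (Gk k).
- exact: in_L2B fL2 gL2.
have Fm k : measurable_fun [set: T] ((F k \- f) \_ A).
  exact: measurable_in_L2 (in_L2B (Fk k) fL2).
have Gm k : measurable_fun [set: T] ((G k \- g) \_ A).
  exact: measurable_in_L2 (in_L2B (Gk k) gL2).
pose dist (H : nat -> T -> R) h k := Lnorm mu 2%:E (EFin \o ((H k \- h) \_ A)).
apply: (@squeeze_cvge _ _ _ _ (cst 0%E) _ (dist F f \+ dist G g)%E).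
- apply: nearW => k /=; rewrite Lnorm_ge0 /=.
  rewrite (_ : ((F k \- G k) \- (f \- g)) \_ A =
    (F k \- f) \_ A \+ (\- ((G k \- g) \_ A))); last first.
    rewrite -restrictN -restrictD; congr restrict.
    by apply/funext => x /=; ring.
  apply: le_trans (eminkowski _ _ _ _) _ => //.
  + exact: measurableT_comp.
  + by rewrite (lee1n 2).
  + by apply: leeD => //; rewrite /dist -[leRHS]oppe_Lnorm.
- exact: cvg_cst.
- by rewrite -[X in _ --> X]adde0; apply: cvgeD.
Qed.

Lemma bounded_in_box (R : realType) (D : set (R * R)) : bounded_set D ->
  exists M, D `<=` `[- M, M] `*` `[- M, M].
Proof.
move=> [M [_ DM]]; exists (M + 1) => x Dx; have := DM (M + 1) _ _ Dx.
rewrite ltrDl ltr01 => /(_ isT) /=; rewrite prod_normE ge_max => /andP[].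
by rewrite !ler_norml => x1 x2; split; rewrite /= in_itv.
Qed.

Lemma continuous_bounded_on (R : realType) (D : set (R * R)) (f : R * R -> R) :
  bounded_set D -> continuous f -> exists M, forall x, D x -> `|f x| <= M.
Proof.
move=> /bounded_in_box[M DM] cf.
have : compact (f @` (`[- M, M] `*` `[- M, M])).
  apply: continuous_compact; first exact: continuous_subspaceT.
  by apply: compact_setX; exact: segment_compact.
move=> /compact_bounded[N [_ fN]]; exists (N + 1) => x Dx.
by apply: fN; rewrite ?ltrDl //; exists x => //; exact: DM.
Qed.

Lemma area_bounded_lty (R : realType) (D : set (R * R)) :
  open D -> bounded_set D -> (area R D < +oo)%E.
Proof.
move=> oD /bounded_in_box[M DM].
pose I : set R := `[- M, M]%classic.
have mI : measurable I by exact: measurable_itv.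
apply: (@le_lt_trans _ _ (area R (I `*` I))).
  by apply: le_measure => //; rewrite inE;
    [exact: open_measurable_prod|exact: measurableX].
have -> : area R (I `*` I) = (lebesgue_measure I * lebesgue_measure I)%E.
  exact: product_measure1E.
rewrite /I lebesgue_measure_itv.
by case: ifP => _; rewrite ?mule0 // -EFinB -EFinM ltry.
Qed.

(** On a set of finite area [`|v| <= 1 + v ^+ 2], so a square integrable [v] is
    integrable, and a continuous function is bounded on a bounded set. *)
Lemma in_L1_mul_continuous (R : realType) (D : set (R * R)) (v f : R * R -> R) :
  open D -> bounded_set D -> in_L2 (area R) D v -> continuous f ->
  in_L1 (area R) D (v \* f).
Proof.
move=> oD bD vL2 cf; have [M fM] := continuous_bounded_on bD cf.
have mD := open_measurable_prod oD.
have D1 : in_L1 (area R) D (cst 1).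
  rewrite /in_L1 -restrict_EFin; apply/integrable_restrict => //.
  rewrite setTI; apply/integrableP.
  split; first by apply/measurable_EFinP; exact: measurable_cst.
  under eq_integral do rewrite /= normr1.
  by rewrite integral_cst // mul1e; exact: area_bounded_lty.
have bound : in_L1 (area R) D (M \*o (cst 1 \+ v \* v)).
  by apply/in_L1Z/in_L1D => //; exact: in_L2M.
apply: in_L1_dominated bound _.
- rewrite restrictM; apply: measurable_funM; first exact: measurable_in_L2 vL2.
  apply/(measurable_restrictT _ mD).
  by apply: measurable_funS (continuous_measurable_prod cf).
- apply: aeW => x Dx /=; rewrite !normrM [leLHS]mulrC.
  have M0 : 0 <= M by apply: le_trans (fM _ Dx).
  apply: (@le_trans _ _ (M * `|v x|)); first by rewrite ler_wpM2r // fM.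
  rewrite (ger0_norm M0) ler_wpM2l // (le_trans _ (ler_norm _)) //.
  rewrite -expr2 -real_normK ?num_real //.
  by have := sqr_ge0 (`|v x| - 1); have := normr_ge0 (v x); nra.
Qed.

Lemma weak_derivativeB (R : realType) (D : set (R * R)) e
    (v v' w w' : R * R -> R) :
  open D -> bounded_set D ->
  (forall f, smooth f -> continuous ('D_e f : R * R -> R)) ->
  in_L2 (area R) D v -> in_L2 (area R) D v' ->
  in_L2 (area R) D w -> in_L2 (area R) D w' ->
  weak_derivative D e v w -> weak_derivative D e v' w' ->
  weak_derivative D e (v \- v') (w \- w').
Proof.
move=> oD bD cD vL2 v'L2 wL2 w'L2 vw vw' phi phiD.
have [sphi _ _] := phiD; have cphi : continuous phi := sphi 0%N.
have cDphi := cD _ sphi.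
under eq_Rintegral do rewrite /= mulrBl.
under [in RHS]eq_Rintegral do rewrite /= mulrBl.
rewrite !Rintegral_onB; [|exact: in_L1_mul_continuous..].
by rewrite vw // vw' // opprB opprK addrC.
Qed.

Lemma is_traceB (R : realType) (D : set (R * R)) (u v : h1fun R) :
  is_trace D u -> is_trace D v -> is_trace D (hsub u v).
Proof.
move=> [phi [sphi u0 ux uy ut]] [psi [spsi v0 vx vy vt]].
exists (fun k => phi k \- psi k); split => [k||||].
- exact: smoothB.
- exact: cvg_LpB u0 v0.
- rewrite (_ : (fun k => _) = (fun k => 'D_((1, 0) : R * R) (phi k) \-
    'D_((1, 0) : R * R) (psi k))).
    exact: cvg_LpB ux vx.
  by apply/funext => k; exact: smooth_deriveB.
- rewrite (_ : (fun k => _) = (fun k => 'D_((0, 1) : R * R) (phi k) \-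
    'D_((0, 1) : R * R) (psi k))).
    exact: cvg_LpB uy vy.
  by apply/funext => k; exact: smooth_deriveB.
- exact: cvg_LpB ut vt.
Qed.

Lemma in_VB (R : realType) (D G1 : set (R * R)) (u v : h1fun R) :
  open D -> bounded_set D -> in_V D G1 u -> in_V D G1 v ->
  in_V D G1 (hsub u v).
Proof.
move=> oD bD [[[u0 ux uy] uwx uwy utr] uG] [[[v0 vx vy] vwx vwy vtr] vG].
split; last first.
  apply: (@filterS2 _ _ (ae_filter_ringOfSetsType (arc_length R))) uG vG.
  by move=> x ux0 vx0 Gx /=; rewrite ux0 // vx0 // subr0.
split; first by split; exact: in_L2B.
- by apply: weak_derivativeB => // f /(_ 1%N)[].
- by apply: weak_derivativeB => // f /(_ 1%N)[].
- exact: is_traceB.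
Qed.

(** * The stability estimate *)

Definition grad_dot (R : realType) (v w : h1fun R) (x : R * R) : R :=
  hdx v x * hdx w x + hdy v x * hdy w x.

Lemma in_V_L2 (R : realType) (D G1 : set (R * R)) (v : h1fun R) :
  in_V D G1 v -> [/\ in_L2 (area R) D (hval v), in_L2 (area R) D (hdx v),
    in_L2 (area R) D (hdy v) & in_L2 (arc_length R) (bnd D) (htrace v)].
Proof. by move=> [[[v0 vx vy] _ _ [phi [_ _ _ _ [_ vt _]]]] _]. Qed.

Lemma in_L1_grad_dot (R : realType) (D G1 : set (R * R)) (v w : h1fun R) :
  in_V D G1 v -> in_V D G1 w -> in_L1 (area R) D (grad_dot v w).
Proof.
move=> /in_V_L2[_ vx vy _] /in_V_L2[_ wx wy _].
by apply: in_L1D; exact: in_L2M.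
Qed.

Lemma sqr_norm_grad (R : realType) (D : set (R * R)) (v : h1fun R) :
  norm_grad D v ^+ 2 = \int[area R]_(x in D) grad_dot v v x.
Proof.
rewrite sqr_sqrtr //.
by apply: Rintegral_ge0 => x _; rewrite addr_ge0 ?sqr_ge0.
Qed.

(** The estimate of the diffusion terms at a point, with [(a, b)] and
    [(a', b')] the gradients of [u] and [u'].  With [p = (a' - a, b' - b)] and
    [t = m' - m], the left-hand side is
    [- m * |p|^2 - t * (|p|^2 + (a, b) . p)]. *)
Lemma coefficient_pointwise (R : realType) (m m' m0 e a b a' b' : R) :
  m0 <= m -> `|m' - m| <= e ->
  m * (a * (a' - a) + b * (b' - b)) + m' * (a' * (a - a') + b' * (b - b')) <=
  (3 / 2 * e - m0) * ((a' - a) * (a' - a) + (b' - b) * (b' - b)) +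
  e / 2 * (a * a + b * b).
Proof.
rewrite ler_norml => m_ge /andP[m'm_ge m'm_le].
rewrite -subr_ge0.
(* The two squares in the last summand are those of (a, b) + p and (a, b) - p;
   this is Young's inequality for t * ((a, b) . p), for either sign of t. *)
have -> : (3 / 2 * e - m0) * ((a' - a) * (a' - a) + (b' - b) * (b' - b)) +
    e / 2 * (a * a + b * b) - (m * (a * (a' - a) + b * (b' - b)) +
    m' * (a' * (a - a') + b' * (b - b'))) =
  (m - m0) * ((a' - a) ^+ 2 + (b' - b) ^+ 2) +
  (e + (m' - m)) * ((a' - a) ^+ 2 + (b' - b) ^+ 2) +
  ((e + (m' - m)) * (a' ^+ 2 + b' ^+ 2) +
   (e - (m' - m)) * ((a' - a - a) ^+ 2 + (b' - b - b) ^+ 2)) / 4.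
  by field.
have sq (x y : R) : 0 <= x ^+ 2 + y ^+ 2 by rewrite addr_ge0 ?sqr_ge0.
have m_ge0 : 0 <= m - m0 by lra.
have eD_ge0 : 0 <= e + (m' - m) by lra.
have eB_ge0 : 0 <= e - (m' - m) by lra.
by apply: addr_ge0; [apply: addr_ge0|apply: divr_ge0 => //; apply: addr_ge0];
  exact: mulr_ge0.
Qed.

Lemma friction_pointwise (R : realType) (L r r' t t' : R) :
  0 <= L -> `|r - r'| <= L * `| `|t| - `|t'| | ->
  r * `|t'| - r * `|t| + (r' * `|t| - r' * `|t'|) <= L * ((t' - t) * (t' - t)).
Proof.
move=> L0.
have -> : r * `|t'| - r * `|t| + (r' * `|t| - r' * `|t'|) =
    (r - r') * (`|t'| - `|t|) by ring.
move=> r_le; apply: le_trans (ler_norm _) _; rewrite normrM.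
rewrite [`| `|t'| - _|]distrC -[(t' - t) * _]expr2 -real_normK ?num_real //.
rewrite [`|t' - t|]distrC expr2 mulrA.
apply: ler_pM => //; last exact: ler_dist_dist.
by apply: le_trans r_le _; rewrite ler_wpM2l // ler_dist_dist.
Qed.

Lemma innerV_hsubC (R : realType) (D G1 : set (R * R)) (f u v : h1fun R) :
  in_V D G1 f -> in_V D G1 (hsub v u) ->
  innerV D f (hsub u v) = - innerV D f (hsub v u).
Proof.
move=> fV vuV; have [f0 _ _ _] := in_V_L2 fV; have [vu0 _ _ _] := in_V_L2 vuV.
have dotL1 := in_L1_grad_dot fV vuV.
rewrite /innerV opprD; congr +%R; rewrite -mulN1r.
  rewrite -(Rintegral_onZ _ (in_L2M f0 vu0)).
  by apply: eq_Rintegral => x _ /=; ring.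
rewrite -(Rintegral_onZ _ dotL1).
by apply: eq_Rintegral => x _; rewrite /grad_dot /=; ring.
Qed.

(** The quantitative form of the convergence result, for a single perturbed
    coefficient.  Its left factor is positive for small [e] because of the
    smallness condition on [Lg]. *)
Lemma norm_grad_stability (R : realType) (D G1 G2 G3 : set (R * R))
    (c0 c3 : R) (mu mu' f0 f2 : R * R -> R) (g : R * R -> R -> R)
    (mustar mustar' Lg e : R) (u u' : h1fun R) :
  open D -> bounded_set D ->
  (@hausdorff1 R).-cara.-measurable G3 -> G3 `<=` bnd D ->
  0 < c0 -> (forall v, in_V D G1 v -> normV D v <= c0 * norm_grad D v) ->
  0 < c3 -> (forall v, in_V D G1 v -> norm_trace G3 v <= c3 * normV D v) ->
  0 < Lg -> friction_bound G3 Lg g ->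
  viscosity D mu mustar -> viscosity D mu' mustar' ->
  {ae area R, forall x, D x -> `|mu' x - mu x| <= e} -> 0 <= e ->
  solves_P D G1 G2 G3 mu f0 f2 g u -> solves_P D G1 G2 G3 mu' f0 f2 g u' ->
  (mustar - Lg * c0 ^+ 2 * c3 ^+ 2 - 3 / 2 * e) * norm_grad D (hsub u' u) ^+ 2
    <= e / 2 * norm_grad D u ^+ 2.
Proof.
move=> oD bD mG3 G3D c00 hc0 c30 hc3 Lg0 gP [muoo _ mum] [mu'oo _ _] mue e0.
move=> [uV [f [fV fload] uVI]] [u'V [f' [f'V f'load] u'VI]].
pose d := hsub u' u; pose s := hsub u u'.
have dV : in_V D G1 d by exact: in_VB.
have sV : in_V D G1 s by exact: in_VB.
have Gtrace v : in_V D G1 v -> in_L2 (arc_length R) G3 (htrace v).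
  by move=> /in_V_L2[_ _ _]; exact: in_L2_subset.
pose phi v x := g x `|htrace v x|.
have phiL2 v : in_V D G1 v -> in_L2 (arc_length R) G3 (phi v).
  by move=> vV; apply: in_L2_friction gP (Gtrace _ vV) => //; exact: ltW.
have jL1 v w : in_V D G1 v -> in_V D G1 w ->
    in_L1 (arc_length R) G3 (fun x => phi v x * `|htrace w x|).
  by move=> vV wV; exact: in_L2M (phiL2 _ vV) (in_L2_norm (Gtrace _ wV)).
(* Both inequalities have the same load functional on V. *)
have load_eq : innerV D f d = - innerV D f' s.
  rewrite -(innerV_hsubC f'V sV).
  by rewrite fload // f'load.
have sum_ge0 : 0 <= (form_a D mu u d + form_a D mu' u' s) +
    (form_j G3 g u u' - form_j G3 g u u +
     (form_j G3 g u' u - form_j G3 g u' u')).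
  have := uVI _ u'V; have := u'VI _ uV; rewrite -/s -/d load_eq; lra.
have a_le : form_a D mu u d + form_a D mu' u' s <=
   (3 / 2 * e - mustar) * norm_grad D d ^+ 2 + e / 2 * norm_grad D u ^+ 2.
  rewrite !sqr_norm_grad /form_a.
  have aL1 := in_LinftyM muoo (in_L1_grad_dot uV dV).
  have a'L1 := in_LinftyM mu'oo (in_L1_grad_dot u'V sV).
  have dL1 := in_L1_grad_dot dV dV; have uL1 := in_L1_grad_dot uV uV.
  rewrite -(Rintegral_onZ _ dL1) -(Rintegral_onZ _ uL1).
  rewrite -(Rintegral_onD aL1 a'L1) -Rintegral_onD; [|exact: in_L1Z..].
  apply: ae_le_Rintegral_on.
  - exact: in_L1D aL1 a'L1.
  - exact: in_L1D (in_L1Z _ dL1) (in_L1Z _ uL1).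
  apply: (@filterS2 _ _ (ae_filter_ringOfSetsType (area R))) mum mue.
  move=> x mux muex Dx.
  exact: coefficient_pointwise (mux Dx) (muex Dx).
have j_le : form_j G3 g u u' - form_j G3 g u u +
    (form_j G3 g u' u - form_j G3 g u' u') <= Lg * norm_trace G3 d ^+ 2.
  have dL2 := Gtrace _ dV.
  rewrite sqr_sqrtr; last by apply: Rintegral_ge0 => x _; exact: sqr_ge0.
  have ddL1 := in_L2M dL2 dL2.
  rewrite -(Rintegral_onZ _ ddL1) /form_j.
  have L11 := jL1 _ _ uV uV; have L12 := jL1 _ _ uV u'V.
  have L21 := jL1 _ _ u'V uV; have L22 := jL1 _ _ u'V u'V.
  rewrite -(Rintegral_onB L12 L11) -(Rintegral_onB L21 L22).
  rewrite -(Rintegral_onD (in_L1B L12 L11) (in_L1B L21 L22)).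
  apply: ae_le_Rintegral_on.
  - exact: in_L1D (in_L1B L12 L11) (in_L1B L21 L22).
  - exact: in_L1Z _ ddL1.
  have [_ glip _ _] := gP.
  move: glip; apply: (@filterS _ _ (ae_filter_ringOfSetsType (arc_length R))).
  move=> x glip Gx.
  exact: friction_pointwise (ltW Lg0) (glip Gx _ _).
have N0 : 0 <= norm_grad D d by exact: sqrtr_ge0.
have V0 : 0 <= normV D d by exact: sqrtr_ge0.
have T0 : 0 <= norm_trace G3 d by exact: sqrtr_ge0.
have trace_le : norm_trace G3 d ^+ 2 <= c0 ^+ 2 * c3 ^+ 2 * norm_grad D d ^+ 2.
  rewrite -!exprMn ler_sqr ?nnegrE ?mulr_ge0 ?(ltW c00) ?(ltW c30) //.
  apply: le_trans (hc3 _ dV) _; rewrite [c0 * c3]mulrC -mulrA ler_pM2l //.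
  exact: hc0.
have : Lg * norm_trace G3 d ^+ 2 <=
    Lg * (c0 ^+ 2 * c3 ^+ 2 * norm_grad D d ^+ 2).
  by rewrite ler_pM2l.
rewrite -/d; lra.
Qed.

(** * Convergence *)

Theorem corollary7 (R : realType) (D G1 G2 G3 : set (R * R)) (c0 c3 : R)
    (mu f0 f2 : R * R -> R) (g : R * R -> R -> R) (mustar Lg : R)
    (mu_ : nat -> R * R -> R) (u : h1fun R) (u_ : nat -> h1fun R) :
  smooth_domain D ->
  boundary_parts D G1 G2 G3 ->
  0 < c0 -> (forall v, in_V D G1 v -> normV D v <= c0 * norm_grad D v) ->
  0 < c3 -> (forall v, in_V D G1 v -> norm_trace G3 v <= c3 * normV D v) ->
  viscosity D mu mustar ->
  in_L2 (area R) D f0 ->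
  in_L2 (arc_length R) G2 f2 ->
  0 < Lg -> friction_bound G3 Lg g ->
  Lg * c0 ^+ 2 * c3 ^+ 2 < mustar ->
  (forall n, exists mustar_n, viscosity D (mu_ n) mustar_n) ->
  cvg_Lp (area R) D +oo%E mu_ mu ->
  solves_P D G1 G2 G3 mu f0 f2 g u ->
  (forall n, solves_P D G1 G2 G3 (mu_ n) f0 f2 g (u_ n)) ->
  normV D (hsub (u_ n) u) @[n --> \oo] --> (0 : R).
Proof.
move=> [oD _ bD _] [[_ _ [U oU G3U]] _ _ _ _] c00 hc0 c30 hc3 muP _ _ Lg0 gP
  small muP_ [_ _ mu_cvg] uP uP_.
have mG3 := rel_open_bnd_measurable oU G3U.
have G3D : G3 `<=` bnd D by rewrite G3U; exact: subIsetl.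
pose kappa := mustar - Lg * c0 ^+ 2 * c3 ^+ 2.
have kappa0 : 0 < kappa by rewrite subr_gt0.
(* The summand 1 allows division by K. *)
pose K := norm_grad D u ^+ 2 + 1.
have K0 : 0 < K by rewrite ltr_wpDl ?sqr_ge0.
apply/cvgrPdist_le => /= eps eps0.
(* The first bound keeps the factor of the stability estimate at least kappa / 2,
   the second makes c0 ^+ 2 * |grad d|^2 at most eps ^+ 2. *)
pose delta := Num.min (kappa / 3) (eps ^+ 2 * kappa / (c0 ^+ 2 * K)).
have c0K : 0 < c0 ^+ 2 * K by rewrite mulr_gt0 ?exprn_gt0.
have delta0 : 0 < delta.
  by rewrite lt_min !divr_gt0 // mulr_gt0 // exprn_gt0.
have mu_near : \forall n \near \oo,
    {ae area R, forall x, D x -> `|mu_ n x - mu x| <= delta}.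
  move/fine_cvgP : mu_cvg => [fin_near /cvgrPdist_le/(_ _ delta0)].
  apply: filterS2 fin_near => n fin; rewrite sub0r normrN => le_delta.
  have : (Lnorm (area R) +oo%E (EFin \o ((mu_ n \- mu)%R \_ D)) <=
          delta%:E)%E.
    by rewrite -(fineK fin) lee_fin (le_trans (ler_norm _)).
  move/(Lnorm_oo_le (ltW delta0)).
  apply: (@filterS _ _ (ae_filter_ringOfSetsType (area R))) => x + Dx.
  by rewrite patchE mem_set.
apply: filterS mu_near => n mu_n; have [mustar_n muP_n] := muP_ n.
have stab := norm_grad_stability oD bD mG3 G3D c00 hc0 c30 hc3 Lg0 gP muP muP_n
  mu_n (ltW delta0) uP (uP_ n).
have dV : in_V D G1 (hsub (u_ n) u) by exact: in_VB oD bD (uP_ n).1 uP.1.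
rewrite sub0r normrN ger0_norm ?sqrtr_ge0 //.
apply: le_trans (hc0 _ dV) _.
have N0 : 0 <= norm_grad D (hsub (u_ n) u) by exact: sqrtr_ge0.
rewrite -ler_sqr ?nnegrE ?mulr_ge0 ?(ltW c00) ?(ltW eps0) // exprMn.
move: (norm_grad D (hsub (u_ n) u)) N0 stab => N N0 stab.
have delta1 : 3 * delta <= kappa.
  by rewrite mulrC -ler_pdivlMr // ge_min lexx.
have delta2 : delta * (c0 ^+ 2 * K) <= eps ^+ 2 * kappa.
  by rewrite -ler_pdivlMr // ge_min lexx orbT.
have N2 : kappa * N ^+ 2 <= delta * K.
  have := sqr_ge0 N; have := ltW delta0; rewrite /K.
  by move: stab; rewrite -/kappa; nra.
rewrite -(ler_pM2l kappa0) [kappa * eps ^+ 2]mulrC (le_trans _ delta2) //.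
rewrite mulrCA [leRHS]mulrCA.
by rewrite ler_pM2l ?exprn_gt0.
Qed.
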